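(* Consider the two-node tandem queueing control problem with data $\lambda,\mu_1,\mu_2,c_1,c_2,h_1,h_2$, action sets $A=[0,a_{max}]$, $B=[0,b_{max}]$, state space $E=\{0,1,2,\dots\}^2$, relative value function $v:E\to\mathbb{R}$ and node operators $T_1,T_2$ (with minimizer sets $\arg T_1v(x)\subseteq A$, $\arg T_2v(x)\subseteq B$). Then the optimal policy is monotone, i.e.: (i) for all $x=(x_1,x_2)\in E$, if $b_1\in\arg T_2v(x+e_2)$ and $b_2\in\arg T_2v(x)$, then $b_1\ge b_2$; (ii) for all $x=(x_1,x_2)\in E$, if $a_1\in\arg T_1v(x+e_1)$ and $a_2\in\arg T_1v(x)$, then $a_1\ge a_2$.
   Context: Model. Customers arrive at node 1 by a Poisson process of rate $\lambda>0$, are served at node 1, then move to node 2, are served there and leave; each node has an infinite FCFS queue. A controller assigns $a\in A=[0,a_{max}]$ units of resource to node 1 and $b\in B=[0,b_{max}]$ to node 2; service at node $i$ with $a$ units is exponential with rate $\mu_i(a)$. Interarrival and service times are mutually independent. For $i=1,2$, $\mu_i$ and $c_i$ are real functions on $[0,\max(a_{max},b_{max})]$ with $\mu_i$ strictly increasing, $\mu_i(0)=0$, and $c_i$ continuous, strictly increasing, $c_i(0)=0$ ($c_i(a)$ is the resource cost per unit time at node $i$). Holding costs accrue at rate $h_i\ge 0$ per unit time per customer at node $i$. Stability: $\lambda<\mu_1(a_{max})$ and $\lambda<\mu_2(b_{max})$. Normalization: $\lambda+\mu_1(a_{max})+\mu_2(b_{max})=1$. The objective is to minimize the long-run average cost over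 stationary Markov policies; only policies under which the queue-length process is irreducible and positive recurrent on $E$ are considered. State $x=(x_1,x_2)\in E=\{0,1,2,\dots\}^2$: $x_i$ is the number of customers at node $i$; $e_1=(1,0)$, $e_2=(0,1)$. Departures from an empty node do not occur. Operators. For $w:E\to\mathbb{R}$, $$T_1w(x)=\min_{a\in A}\{\mu_1(a)w(x-e_1+e_2)+[\mu_1(a_{max})-\mu_1(a)]w(x)+c_1(a)\},$$ $$T_2w(x)=\min_{b\in B}\{\mu_2(b)w(x-e_2)+[\mu_2(b_{max})-\mu_2(b)]w(x)+c_2(b)\},$$ $$Tw(x)=\lambda w(x+e_1)+T_1w(x)+T_2w(x)+h_1x_1+h_2x_2,$$ where $w(x-e_1+e_2)$ is replaced by $w(x)$ if $x_1=0$, and $w(x-e_2)$ is replaced by $w(x)$ if $x_2=0$. $\arg T_iw(x)$ is the set of minimizers in $T_iw(x)$. Relative value function. With $v_0\equiv0$ and $v_{n+1}=Tv_n$, $v(x)=\lim_{n\to\infty}[v_n(x)-v_n(x_{ref})]$ for a fixed reference state $x_{ref}\in E$; the existence of the limit is a standing assumption, as is that $v$ satisfies the optimality equation $Tv(x)=v(x)+g$ for all $x\in E$, $g$ being the minimal long-run average cost. Standing modelling assumption: the action at node $i$ depends only on the number of customers at node $i$; that is, the optimal policy is $f(x)=(f_1(x_1),f_2(x_2))$ with $f_1(x_1)=\arg T_1v(x)$ and $f_2(x_2)=\arg T_2v(x)$, so $\arg T_1v(x)$ depends on $x$ only through $x_1$ and $\arg T_2v(x)$ only through $x_2$. *)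

(* Defs.v *)
From HB Require Import structures.
From mathcomp Require Import all_boot all_order all_algebra.
From mathcomp Require Import all_classical all_reals all_analysis.

Set Implicit Arguments.
Unset Strict Implicit.
Unset Printing Implicit Defensive.

Import Order.TTheory GRing.Theory Num.Theory.
Import numFieldNormedType.Exports.

Local Open Scope classical_set_scope.
Local Open Scope ring_scope.

(* (x_1, x_2): numbers of customers at nodes 1 and 2. *)
Definition state := (nat * nat)%type.

Definition add_e1 (x : state) : state := (x.1.+1, x.2).
Definition add_e2 (x : state) : state := (x.1, x.2.+1).

(* x - e_1 + e_2 and x - e_2, replaced by x itself when the node that should
   release a customer is empty. *)
Definition depart1 (x : state) : state :=
  if x.1 is k.+1 then (k, x.2.+1) else x.
Definition depart2 (x : state) : state :=
  if x.2 is k.+1 then (x.1, k) else x.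

Record tandem (R : realType) := Tandem {
  lam : R;
  mu1 : R -> R;
  mu2 : R -> R;
  c1 : R -> R;
  c2 : R -> R;
  h1 : R;
  h2 : R;
  amax : R;
  bmax : R
}.

Definition actions1 (R : realType) (Q : tandem R) : set R :=
  [set a | 0 <= a <= amax Q].
Definition actions2 (R : realType) (Q : tandem R) : set R :=
  [set b | 0 <= b <= bmax Q].

Definition resources (R : realType) (Q : tandem R) : set R :=
  [set a | 0 <= a <= Num.max (amax Q) (bmax Q)].

Definition service_rate_on (R : realType) (D : set R) (mu : R -> R) : Prop :=
  (forall a b, D a -> D b -> a < b -> mu a < mu b) /\ mu 0 = 0.

Definition resource_cost_on (R : realType) (D : set R) (c : R -> R) : Prop :=
  [/\ {within D, continuous c},
      (forall a b, D a -> D b -> a < b -> c a < c b) & c 0 = 0].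

Record tandem_model (R : realType) (Q : tandem R) : Prop := TandemModel {
  amax_ge0 : 0 <= amax Q;
  bmax_ge0 : 0 <= bmax Q;
  lam_gt0 : 0 < lam Q;
  mu1_rate : service_rate_on (resources Q) (mu1 Q);
  mu2_rate : service_rate_on (resources Q) (mu2 Q);
  c1_cost : resource_cost_on (resources Q) (c1 Q);
  c2_cost : resource_cost_on (resources Q) (c2 Q);
  h1_ge0 : 0 <= h1 Q;
  h2_ge0 : 0 <= h2 Q;
  stable1 : lam Q < mu1 Q (amax Q);
  stable2 : lam Q < mu2 Q (bmax Q);
  normalized : lam Q + mu1 Q (amax Q) + mu2 Q (bmax Q) = 1
}.

Definition T1_obj (R : realType) (Q : tandem R) (w : state -> R) (x : state)
    (a : R) : R :=
  mu1 Q a * w (depart1 x) + (mu1 Q (amax Q) - mu1 Q a) * w x + c1 Q a.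

Definition T2_obj (R : realType) (Q : tandem R) (w : state -> R) (x : state)
    (b : R) : R :=
  mu2 Q b * w (depart2 x) + (mu2 Q (bmax Q) - mu2 Q b) * w x + c2 Q b.

(* The minimum is rendered by the total operator [inf]: the set is nonempty and
   bounded below in the model, so this is the minimum whenever it is attained
   (which is not automatic, the rates not being assumed continuous). *)
Definition T1 (R : realType) (Q : tandem R) (w : state -> R) (x : state) : R :=
  inf (T1_obj Q w x @` actions1 Q).
Definition T2 (R : realType) (Q : tandem R) (w : state -> R) (x : state) : R :=
  inf (T2_obj Q w x @` actions2 Q).

Definition holding_cost (R : realType) (Q : tandem R) (x : state) : R :=
  h1 Q * x.1%:R + h2 Q * x.2%:R.

Definition T (R : realType) (Q : tandem R) (w : state -> R) (x : state) : R :=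
  lam Q * w (add_e1 x) + T1 Q w x + T2 Q w x + holding_cost Q x.

Definition arg_T1 (R : realType) (Q : tandem R) (w : state -> R) (x : state) :
    set R :=
  [set a | actions1 Q a /\
           forall a', actions1 Q a' -> T1_obj Q w x a <= T1_obj Q w x a'].
Definition arg_T2 (R : realType) (Q : tandem R) (w : state -> R) (x : state) :
    set R :=
  [set b | actions2 Q b /\
           forall b', actions2 Q b' -> T2_obj Q w x b <= T2_obj Q w x b'].

Definition value_iter (R : realType) (Q : tandem R) (n : nat) : state -> R :=
  iter n (T Q) (fun=> 0).

Definition is_relative_value (R : realType) (Q : tandem R) (xref : state)
    (v : state -> R) : Prop :=
  forall x,
    (fun n => value_iter Q n x - value_iter Q n xref) @ \oo --> v x.

(* A stationary Markov policy maps a state to the pair (a, b). *)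
Definition policy (R : realType) := state -> R * R.

Definition feasible (R : realType) (Q : tandem R) (f : policy R) : Prop :=
  forall x, actions1 Q (f x).1 /\ actions2 Q (f x).2.

(* One-step expectation E_x[w(X_1)] for the queue-length process under f,
   uniformized at total rate lam + mu1 amax + mu2 bmax = 1 (unused service
   capacity gives fictitious self-transitions). Since the uniformization clock
   has rate 1, irreducibility, positive recurrence and long-run average cost
   per unit time are those of the continuous-time process. *)
Definition step (R : realType) (Q : tandem R) (f : policy R) (w : state -> R)
    (x : state) : R :=
  lam Q * w (add_e1 x)
  + (mu1 Q (f x).1 * w (depart1 x)
     + (mu1 Q (amax Q) - mu1 Q (f x).1) * w x)
  + (mu2 Q (f x).2 * w (depart2 x)
     + (mu2 Q (bmax Q) - mu2 Q (f x).2) * w x).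

(* P_x(X_n = y) *)
Definition trans_prob (R : realType) (Q : tandem R) (f : policy R) (n : nat)
    (x y : state) : R :=
  iter n (step Q f) (fun z => (z == y)%:R) x.

(* P_x(tau_y = n), where tau_y = min {n >= 1 | X_n = y} *)
Definition first_passage_prob (R : realType) (Q : tandem R) (f : policy R)
    (n : nat) (x y : state) : R :=
  if n is m.+1 then
    iter m (fun u => step Q f (fun z => if z == y then 0 else u z))
      (step Q f (fun z => (z == y)%:R)) x
  else 0.

Definition irreducible (R : realType) (Q : tandem R) (f : policy R) : Prop :=
  forall x y, exists n, 0 < trans_prob Q f n x y.

Definition positive_recurrent (R : realType) (Q : tandem R) (f : policy R) :
    Prop :=
  forall x,
    series (fun n => first_passage_prob Q f n x x) @ \oo --> (1 : R) /\
    cvgn (series (fun n => n%:R * first_passage_prob Q f n x x)).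

Definition admissible (R : realType) (Q : tandem R) (f : policy R) : Prop :=
  [/\ feasible Q f, irreducible Q f & positive_recurrent Q f].

Definition cost_rate (R : realType) (Q : tandem R) (f : policy R) (x : state) :
    R :=
  c1 Q (f x).1 + c2 Q (f x).2 + holding_cost Q x.

(* expected cost E_x[cost_rate X_0 + ... + cost_rate X_{n-1}] *)
Definition total_cost (R : realType) (Q : tandem R) (f : policy R) (n : nat) :
    state -> R :=
  iter n (fun w x => cost_rate Q f x + step Q f w x) (fun=> 0).

Definition average_cost (R : realType) (Q : tandem R) (f : policy R)
    (x : state) : \bar R :=
  limn_esup (fun n => (total_cost Q f n x / n%:R)%:E).

Definition optimal_policy (R : realType) (Q : tandem R) (f : policy R) (g : R) :
    Prop :=
  [/\ admissible Q f,
      (forall x, average_cost Q f x = g%:E) &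
      (forall f', admissible Q f' -> forall x,
         (g%:E <= average_cost Q f' x)%E)].

(* The minimizing actions at a node depend on the state only through the number
   of customers at that node, and f1, f2 select such actions (the argmin sets
   are not required to be singletons). *)
Definition local_minimizers (R : realType) (Q : tandem R) (v : state -> R)
    (f1 f2 : nat -> R) : Prop :=
  [/\ (forall x y, x.1 = y.1 -> arg_T1 Q v x = arg_T1 Q v y),
      (forall x y, x.2 = y.2 -> arg_T2 Q v x = arg_T2 Q v y),
      (forall x, arg_T1 Q v x (f1 x.1)) &
      (forall x, arg_T2 Q v x (f2 x.2))].

(* Main.v *)
(* Each T_i w has the form mu_i(max) w + F_i (w - w \o depart_i), where F_i d is
   the infimum of c_i - mu_i d; F_i is concave, nonincreasing and
   mu_i(max)-Lipschitz, so T preserves multimodularity, and v inherits it from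
   the iterates v_n. Hence the decrease of v at a departure from a node is nondecreasing
   in its queue length, which orders the minimizers when it strictly increases.
   A tie between two distinct minimizers fixes the value of this decrease; as
   the minimizers depend on one queue length only, it is then independent of the
   other one. The optimality equation equates v + g with a sum of multimodular
   terms, so that tightness spreads to each term and the linear behaviour
   propagates until v (i, 1) - v (i, 0) = v (i, 2) - v (i, 1) = d for all i. The
   optimality equation at (0, 0) and (0, 1) then gives h_2 = 0, in which case v
   does not depend on x_2 and node 2 is never served, against irreducibility. *)
Require Import Defs.
From HB Require Import structures.
From mathcomp Require Import all_boot all_order all_algebra.
From mathcomp Require Import all_classical all_reals all_analysis.
From mathcomp Require Import ring lra.

Set Implicit Arguments.
Unset Strict Implicit.
Unset Printing Implicit Defensive.

Import Order.TTheory GRing.Theory Num.Theory.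
Import numFieldNormedType.Exports.

Local Open Scope classical_set_scope.
Local Open Scope ring_scope.

(** * Control of a single server *)

(** One node on its own action interval [0, m], so that a single analysis covers both nodes. *)
Record server (R : realType) (mu c : R -> R) (m : R) : Prop := Server {
  server_max_ge0 : 0 <= m;
  server_rate_lt : forall a b, 0 <= a -> a < b -> b <= m -> mu a < mu b;
  server_rate0 : mu 0 = 0;
  server_cost_lt : forall a b, 0 <= a -> a < b -> b <= m -> c a < c b;
  server_cost0 : c 0 = 0
}.

Lemma server1 (R : realType) (Q : tandem R) :
  tandem_model Q -> server (mu1 Q) (c1 Q) (amax Q).
Proof.
move=> [a0 b0 _ [mu_lt mu0] _ [_ c_lt c0] _ _ _ _ _ _].
have inR a : 0 <= a -> a <= amax Q -> resources Q a.
  by move=> ? ?; rewrite /resources /= le_max; apply/andP; split=> //; apply/orP; left.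
by split=> // a b ? ? ?; [apply: mu_lt|apply: c_lt] => //; apply: inR; lra.
Qed.

Lemma server2 (R : realType) (Q : tandem R) :
  tandem_model Q -> server (mu2 Q) (c2 Q) (bmax Q).
Proof.
move=> [a0 b0 _ _ [mu_lt mu0] _ [_ c_lt c0] _ _ _ _ _].
have inR a : 0 <= a -> a <= bmax Q -> resources Q a.
  by move=> ? ?; rewrite /resources /= le_max; apply/andP; split=> //; apply/orP; right.
by split=> // a b ? ? ?; [apply: mu_lt|apply: c_lt] => //; apply: inR; lra.
Qed.

Section Gain.
Context (R : realType) (mu c : R -> R) (m : R).

(** Here [d] is the decrease of the value function at a departure; minus [gain] is the Legendre
    conjugate of the cost as a function of the rate. *)
Definition gain (d : R) : R :=
  inf ((fun a => c a - mu a * d) @` [set a | 0 <= a <= m]).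

Definition best (d a : R) : Prop :=
  0 <= a <= m /\ forall a', 0 <= a' <= m -> c a - mu a * d <= c a' - mu a' * d.

Hypothesis S : server mu c m.

Lemma server_rate_itv a : 0 <= a <= m -> 0 <= mu a <= mu m.
Proof.
move=> /andP[a0 am]; apply/andP; split.
  move: a0; rewrite le_eqVlt => /orP[/eqP <-|a0]; first by rewrite (server_rate0 S).
  by rewrite -(server_rate0 S) ltW// (server_rate_lt S).
move: am; rewrite le_eqVlt => /orP[/eqP -> //|am].
by rewrite ltW// (server_rate_lt S).
Qed.

Lemma server_rate_max_ge0 : 0 <= mu m.
Proof.
have /server_rate_itv/andP[//] : 0 <= m <= m by rewrite (server_max_ge0 S) lexx.
Qed.

Lemma server_cost_ge0 a : 0 <= a <= m -> 0 <= c a.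
Proof.
move=> /andP[a0 am].
move: a0; rewrite le_eqVlt => /orP[/eqP <-|a0]; first by rewrite (server_cost0 S).
by rewrite -(server_cost0 S) ltW// (server_cost_lt S).
Qed.

Lemma gain_le d a : 0 <= a <= m -> gain d <= c a - mu a * d.
Proof.
move=> am; apply: ge_inf; last by exists a.
(* An infimum bounds its set only if the set is bounded below; this bound comes from 0 <= mu b <= mu
   m and c b >= 0. *)
exists (- (mu m * `|d|)) => _ [b /= bm <-].
have /andP[mb0 mbm] := server_rate_itv bm.
have := server_cost_ge0 bm; have := ler_norm d; have := normr_ge0 d.
by nra.
Qed.

Lemma gain_ge d y :
  (forall a, 0 <= a <= m -> y <= c a - mu a * d) -> y <= gain d.
Proof.
move=> H; apply: lb_le_inf; last by move=> _ [a am <-]; exact: H.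
by exists (c 0 - mu 0 * d); exists 0 => //=; rewrite lexx (server_max_ge0 S).
Qed.

Lemma gain_le0 d : gain d <= 0.
Proof.
have /gain_le -/(_ d) : 0 <= (0 : R) <= m by rewrite lexx (server_max_ge0 S).
by rewrite (server_rate0 S) (server_cost0 S) mul0r subr0.
Qed.

Lemma gain0 : gain 0 = 0.
Proof.
apply/le_anti/andP; split; first exact: gain_le0.
by apply: gain_ge => a am; rewrite mulr0 subr0; exact: server_cost_ge0.
Qed.

Lemma gain_anti d d' : d <= d' -> gain d' <= gain d.
Proof.
move=> dd; apply: gain_ge => a am; have := gain_le d' am.
by have /andP[] := server_rate_itv am; nra.
Qed.

Lemma gain_lip d d' : d <= d' -> gain d + mu m * d <= gain d' + mu m * d'.
Proof.
move=> dd; suff : gain d + mu m * d - mu m * d' <= gain d' by lra.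
apply: gain_ge => a am; have := gain_le d am.
by have /andP[] := server_rate_itv am; nra.
Qed.

(* Exchange argument: of two actions used at [y] and [z], the one with the
   smaller rate is reused at the smallest argument [x]. *)
Lemma gain_exchange x y z t u :
  x <= y -> x <= z -> y <= t -> z <= t -> y + z <= x + t + u -> 0 <= u ->
  gain x + gain t <= gain y + gain z + mu m * u.
Proof.
move=> xy xz yt zt yzu u0.
suff : gain x + gain t - gain z - mu m * u <= gain y by lra.
apply: gain_ge => a am.
suff : gain x + gain t - mu m * u - (c a - mu a * y) <= gain z by lra.
apply: gain_ge => b bm.
have /andP[? ?] := server_rate_itv am; have /andP[? ?] := server_rate_itv bm.
have := gain_le x am; have := gain_le t am.
have := gain_le x bm; have := gain_le t bm.
by case: (leP (mu a) (mu b)) => ?; nra.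
Qed.

Lemma best_gain d a : best d a -> gain d = c a - mu a * d.
Proof.
by move=> [am H]; apply/le_anti/andP; split; [exact: gain_le|exact: gain_ge].
Qed.

(** Adding the two optimality inequalities gives (mu a - mu a') * (d' - d) <= 0, and [mu] is
    strictly increasing. *)
Lemma best_mono d d' a a' : d < d' -> best d a -> best d' a' -> a <= a'.
Proof.
move=> dd [am Ha] [a'm Ha']; rewrite leNgt; apply/negP => lt.
have mlt : mu a' < mu a.
  by move: am a'm => /andP[? ?] /andP[? ?]; apply: (server_rate_lt S).
by have := Ha _ a'm; have := Ha' _ am; nra.
Qed.

(** At distinct arguments [best_mono] would put the larger action below the smaller one. Hence a tie
    fixes the argument. *)
Lemma best_inj d d' a a' : a < a' ->
  best d a -> best d a' -> best d' a -> best d' a' -> d = d'.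
Proof.
move=> aa da da' d'a d'a'; case: (ltgtP d d') => // dd.
  by have := best_mono dd da' d'a; rewrite leNgt aa.
by have := best_mono dd d'a' da; rewrite leNgt aa.
Qed.

Lemma best0 a : best 0 a -> a = 0.
Proof.
move=> [/andP[a0 am] H]; apply/eqP; rewrite eq_le a0 andbT leNgt; apply/negP => lt.
have := H 0; rewrite lexx (server_max_ge0 S) !mulr0 !subr0 => /(_ isT).
by rewrite leNgt (server_cost_lt S).
Qed.

(** Reusing [a], whose rate is positive, at a larger argument strictly lowers the objective. *)
Lemma gain_inj d d' a : best d a -> 0 < a -> d <= d' -> gain d' = gain d -> d' = d.
Proof.
move=> da a0 dd gE; apply/le_anti/andP; split=> //; rewrite leNgt; apply/negP => lt.
have [am _] := da; have := gain_le d' am; rewrite gE (best_gain da).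
have : 0 < mu a.
  by rewrite -(server_rate0 S); move: am => /andP[_ am]; apply: (server_rate_lt S).
by nra.
Qed.

Lemma inf_control p q :
  inf ((fun a => mu a * p + (mu m - mu a) * q + c a) @` [set a | 0 <= a <= m])
  = mu m * q + gain (q - p).
Proof.
have E a : mu a * p + (mu m - mu a) * q + c a = mu m * q + (c a - mu a * (q - p)).
  by ring.
apply/le_anti/andP; split.
  rewrite -lerBlDl; apply: gain_ge => a am; rewrite lerBlDl -E.
  apply: ge_inf; last by exists a.
  by exists (mu m * q + gain (q - p)) => _ [b bm <-]; rewrite E lerD2l gain_le.
apply: lb_le_inf; last by move=> _ [b bm <-]; rewrite E lerD2l gain_le.
eexists; exists 0; last reflexivity.
by rewrite /= lexx (server_max_ge0 S).
Qed.

End Gain.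

(** * Multimodularity and its preservation by the operators *)

(* Submodularity along the three moves e1, e2 - e1 and - e2, at the states where
   these moves stay in the quadrant. *)
Record multimodular (R : realType) (w : state -> R) : Prop := Multimodular {
  multimodular01 : forall i j,
    w (i.+1, j.+1) + w (i.+1, j) <= w (i, j.+1) + w (i.+2, j);
  multimodular02 : forall i j,
    w (i.+1, j) + w (i, j.+1) <= w (i.+1, j.+1) + w (i, j);
  multimodular12 : forall i j,
    w (i, j.+1) + w (i.+1, j.+1) <= w (i, j.+2) + w (i.+1, j)
}.

Lemma multimodular_convex2 (R : realType) (w : state -> R) i j :
  multimodular w -> w (i, j.+1) + w (i, j.+1) <= w (i, j) + w (i, j.+2).
Proof. by case=> _ H2 H3; have := H2 i j; have := H3 i j; lra. Qed.

Lemma T1E (R : realType) (Q : tandem R) (w : state -> R) x : tandem_model Q ->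
  T1 Q w x = mu1 Q (amax Q) * w x
             + gain (mu1 Q) (c1 Q) (amax Q) (w x - w (depart1 x)).
Proof. by move=> /server1 S; exact: (inf_control S). Qed.

Lemma T2E (R : realType) (Q : tandem R) (w : state -> R) x : tandem_model Q ->
  T2 Q w x = mu2 Q (bmax Q) * w x
             + gain (mu2 Q) (c2 Q) (bmax Q) (w x - w (depart2 x)).
Proof. by move=> /server2 S; exact: (inf_control S). Qed.

(** Inequalities 01 and 12 pair the gains, one pair by [gain_lip], the other by [gain_anti]; 02
    needs [gain_exchange]. At x_1 = 0 no departure occurs and the gain is F 0 = 0. *)
Lemma multimodular_T1 (R : realType) (Q : tandem R) (w : state -> R) :
  tandem_model Q -> multimodular w -> multimodular (T1 Q w).
Proof.
move=> Qm mm; have S := server1 Qm.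
have [H1 H2 H3] := mm.
split=> i j; rewrite !T1E// /depart1 /=; set F := gain _ _ _.
- have H := H1 i j.
  have := @gain_lip _ _ _ _ S (w (i.+1, j) - w (i, j.+1))
    (w (i.+2, j) - w (i.+1, j.+1)) ltac:(lra).
  case: i H => [|k] H; rewrite -/F.
    rewrite subrr (gain0 S : F 0 = 0).
    by have := gain_le0 S (w (1%N, j.+1) - w (0%N, j.+2)); rewrite -/F; lra.
  have := H1 k j.+1 => H'.
  have := gain_anti S (_ : w (k.+1, j.+1) - w (k, j.+2)
    <= w (k.+2, j.+1) - w (k.+1, j.+2)) => /(_ ltac:(lra)); rewrite -/F.
  by lra.
- have H := H2 i j; case: i H => [|k] H.
    have C := multimodular_convex2 0 j mm.
    rewrite !subrr (gain0 S : F 0 = 0).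
    (* [s] is the slack of 02 for [w]; convexity in x_2 bounds the decrease at (1, j + 1) by that at
       (1, j) plus [s]. *)
    set s := w (1%N, j.+1) + w (0%N, j) - w (1%N, j) - w (0%N, j.+1).
    have := @gain_anti _ _ _ _ S (w (1%N, j.+1) - w (0%N, j.+2))
      (w (1%N, j) - w (0%N, j.+1) + s) ltac:(rewrite /s; lra).
    have := @gain_lip _ _ _ _ S (w (1%N, j) - w (0%N, j.+1))
      (w (1%N, j) - w (0%N, j.+1) + s) ltac:(rewrite /s; lra).
    by rewrite -/F /s; lra.
  (* The last argument is the slack of 02 for [w]; the terms mu1(amax) * w pay for it. *)
  have := @gain_exchange _ _ _ _ S (w (k.+1, j.+1) - w (k, j.+2))
    (w (k.+2, j.+1) - w (k.+1, j.+2)) (w (k.+1, j) - w (k, j.+1))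
    (w (k.+2, j) - w (k.+1, j.+1))
    (w (k.+2, j.+1) + w (k.+1, j) - w (k.+2, j) - w (k.+1, j.+1)).
  have ? := H1 k j; have ? := H1 k j.+1; have ? := H3 k j; have ? := H3 k.+1 j.
  have ? := H2 k j.+1.
  do 6 (move=> /(_ ltac:(lra))); rewrite -/F; lra.
- have H := H3 i j.
  have := @gain_lip _ _ _ _ S (w (i.+1, j.+1) - w (i, j.+2))
    (w (i.+1, j) - w (i, j.+1)) ltac:(lra).
  case: i H => [|k] H; rewrite -/F; first by rewrite !subrr; lra.
  have := @gain_anti _ _ _ _ S (w (k.+1, j.+2) - w (k, j.+3))
    (w (k.+1, j.+1) - w (k, j.+2)).
  have ? := H3 k j.+1.
  by move=> /(_ ltac:(lra)); rewrite -/F; lra.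
Qed.

(* The move - e2 plays here the part that e2 - e1 plays in [multimodular_T1]. *)
Lemma multimodular_T2 (R : realType) (Q : tandem R) (w : state -> R) :
  tandem_model Q -> multimodular w -> multimodular (T2 Q w).
Proof.
move=> Qm mm; have S := server2 Qm.
have [H1 H2 H3] := mm.
split=> i j; rewrite !T2E// /depart2 /=; set F := gain _ _ _.
- have H := H1 i j; case: j H => [|k] H.
    have := gain_anti S (_ : w (i, 1%N) - w (i, 0%N)
      <= w (i.+1, 1%N) - w (i.+1, 0%N)) => /(_ ltac:(have := H2 i 0%N; lra)).
    have := mulr_ge0 (server_rate_max_ge0 S) (_ : 0 <= w (i, 1%N) + w (i.+2, 0%N)
      - w (i.+1, 1%N) - w (i.+1, 0%N)) => /(_ ltac:(lra)).
    by rewrite !subrr (gain0 S : F 0 = 0) -/F; lra.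
  have := @gain_exchange _ _ _ _ S (w (i.+1, k.+1) - w (i.+1, k))
    (w (i, k.+2) - w (i, k.+1)) (w (i.+2, k.+1) - w (i.+2, k))
    (w (i.+1, k.+2) - w (i.+1, k.+1))
    (w (i, k.+2) + w (i.+2, k.+1) - w (i.+1, k.+2) - w (i.+1, k.+1)).
  have ? := H1 i k; have ? := H3 i k; have ? := H3 i.+1 k.
  have ? := H2 i.+1 k; have ? := H2 i k.+1.
  do 6 (move=> /(_ ltac:(lra))); rewrite -/F; lra.
- have H := H2 i j.
  have := @gain_lip _ _ _ _ S (w (i, j.+1) - w (i, j))
    (w (i.+1, j.+1) - w (i.+1, j)) ltac:(lra).
  case: j H => [|k] H; rewrite -/F; first by rewrite !subrr; lra.
  have := @gain_anti _ _ _ _ S (w (i, k.+1) - w (i, k))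
    (w (i.+1, k.+1) - w (i.+1, k)) ltac:(have := H2 i k; lra).
  by rewrite -/F; lra.
- have H := H3 i j.
  have := @gain_lip _ _ _ _ S (w (i.+1, j.+1) - w (i.+1, j))
    (w (i, j.+2) - w (i, j.+1)) ltac:(lra).
  case: j H => [|k] H; rewrite -/F.
    rewrite subrr (gain0 S : F 0 = 0).
    by have := gain_le0 S (w (i, 1%N) - w (i, 0%N)); rewrite -/F; lra.
  have := @gain_anti _ _ _ _ S (w (i.+1, k.+1) - w (i.+1, k))
    (w (i, k.+2) - w (i, k.+1)) ltac:(have := H3 i k; lra).
  by rewrite -/F; lra.
Qed.

Lemma multimodular_T (R : realType) (Q : tandem R) (w : state -> R) :
  tandem_model Q -> multimodular w -> multimodular (T Q w).
Proof.
move=> Qm mm; have [A1 A2 A3] := multimodular_T1 Qm mm.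
have [B1 B2 B3] := multimodular_T2 Qm mm.
have l0 := lam_gt0 Qm; case: mm => H1 H2 H3.
split=> i j; rewrite /T /holding_cost /add_e1 /=.
- by have := ler_wpM2l (ltW l0) (H1 i.+1 j); have := A1 i j; have := B1 i j;
    rewrite -!natr1; lra.
- by have := ler_wpM2l (ltW l0) (H2 i.+1 j); have := A2 i j; have := B2 i j;
    rewrite -!natr1; lra.
- by have := ler_wpM2l (ltW l0) (H3 i.+1 j); have := A3 i j; have := B3 i j;
    rewrite -!natr1; lra.
Qed.

Lemma multimodular_value_iter (R : realType) (Q : tandem R) n :
  tandem_model Q -> multimodular (value_iter Q n).
Proof.
move=> Qm; elim: n => [|n IH]; last exact: multimodular_T.
by split=> i j; rewrite /value_iter /= lexx.
Qed.

(** The inequalities have two values on each side, so the normalizing constants cancel and the limit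
    preserves them. *)
Lemma multimodular_relative_value (R : realType) (Q : tandem R) xref v :
  tandem_model Q -> is_relative_value Q xref v -> multimodular v.
Proof.
move=> Qm lim_v.
have lim_le x y z t : (forall n, value_iter Q n x + value_iter Q n y
    <= value_iter Q n z + value_iter Q n t) -> v x + v y <= v z + v t.
  move=> H; apply: (ler_cvg_to (cvgD (lim_v x) (lim_v y))
    (cvgD (lim_v z) (lim_v t))).
  by near=> n; have := H n; rewrite !fctE; lra.
by split=> i j; apply: lim_le => n; case: (multimodular_value_iter n Qm).
Unshelve. all: by end_near. Qed.

(** * Closed sets and irreducibility *)

Lemma step0_closed (R : realType) (Q : tandem R) f (D : state -> Prop) u :
  (forall x, D x -> D (add_e1 x)) ->
  (forall x, D x -> D (depart1 x) \/ mu1 Q (f x).1 = 0) ->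
  (forall x, D x -> D (depart2 x) \/ mu2 Q (f x).2 = 0) ->
  (forall x, D x -> u x = 0) -> forall x, D x -> step Q f u x = 0.
Proof.
move=> De D1 D2 u0 x Dx; rewrite /step (u0 _ (De _ Dx)) (u0 _ Dx).
have [/u0 -> | ->] := D1 x Dx; have [/u0 -> | ->] := D2 x Dx;
  by rewrite ?mulr0 ?mul0r ?addr0.
Qed.

(** The indicator of [y] vanishes on the closed set [D], and each step keeps it zero there. *)
Lemma irreducible_not_closed (R : realType) (Q : tandem R) f
    (D : state -> Prop) x y : irreducible Q f -> D x -> ~ D y ->
  (forall x, D x -> D (add_e1 x)) ->
  (forall x, D x -> D (depart1 x) \/ mu1 Q (f x).1 = 0) ->
  (forall x, D x -> D (depart2 x) \/ mu2 Q (f x).2 = 0) -> False.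
Proof.
move=> irr Dx nDy De D1 D2; have [n] := irr x y.
suff -> : trans_prob Q f n x y = 0 by rewrite ltxx.
elim: n x Dx => [|n IH] x Dx.
  by rewrite /trans_prob /=; case: eqP => // E; rewrite E in Dx.
exact: (step0_closed De D1 D2 IH).
Qed.

(** With node 1 idle at length k + 1, the set x_1 > k would be closed. *)
Lemma irreducible_serves1 (R : realType) (Q : tandem R) (f1 f2 : nat -> R) k :
  tandem_model Q -> irreducible Q (fun x => (f1 x.1, f2 x.2)) ->
  f1 k.+1 <> 0.
Proof.
move=> Qm irr f0.
apply: (@irreducible_not_closed _ _ _ (fun x => k < x.1)%N (k.+1, 0%N) (0%N, 0%N)
  irr) => //=.
- by move=> [i j] /= ki; exact: (leq_trans ki).
- move=> [[|i] j] //=; rewrite ltnS leq_eqVlt => /orP[/eqP <-|ki]; last by left.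
  by right; rewrite f0 (server_rate0 (server1 Qm)).
- by move=> [i [|j]] /= ki; left.
Qed.

Lemma irreducible_serves2 (R : realType) (Q : tandem R) (f1 f2 : nat -> R) k :
  tandem_model Q -> irreducible Q (fun x => (f1 x.1, f2 x.2)) ->
  f2 k.+1 <> 0.
Proof.
move=> Qm irr f0.
apply: (@irreducible_not_closed _ _ _ (fun x => k < x.2)%N (0%N, k.+1) (0%N, 0%N)
  irr) => //=.
- move=> [[|i] j] /= kj; left => //; exact: (leq_trans kj).
- move=> [i [|j]] //=; rewrite ltnS leq_eqVlt => /orP[/eqP <-|kj]; last by left.
  by right; rewrite f0 (server_rate0 (server2 Qm)).
Qed.

(** * The case of no holding cost at node 2 *)

(** If the iterate is free of x_2, a departure from node 2 brings no decrease, so its gain is 0 and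
    nothing in [T] depends on x_2. *)
Lemma value_iter_free2 (R : realType) (Q : tandem R) n i j :
  tandem_model Q -> h2 Q = 0 -> value_iter Q n (i, j) = value_iter Q n (i, 0%N).
Proof.
move=> Qm h0; elim: n i j => [//|n IH] i j.
have S2 := server2 Qm.
rewrite /value_iter !iterS -/(value_iter Q n) /T !T1E// !T2E//.
rewrite /holding_cost /add_e1 h0 !mul0r /= (IH i.+1 j) (IH i j) subrr.
have -> : value_iter Q n (depart2 (i, j)) = value_iter Q n (i, 0%N).
  by case: j => [|j] //=; exact: IH.
suff -> : value_iter Q n (depart1 (i, j)) = value_iter Q n (depart1 (i, 0%N)).
  by rewrite subrr.
by case: i => [|i] /=; [exact: IH|rewrite IH [RHS]IH].
Qed.

Lemma relative_value_free2 (R : realType) (Q : tandem R) xref v i j :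
  tandem_model Q -> h2 Q = 0 -> is_relative_value Q xref v ->
  v (i, j) = v (i, 0%N).
Proof.
move=> Qm h0 lim_v; apply: (cvg_unique _ (lim_v (i, j))) => //.
have -> : (fun n => value_iter Q n (i, j) - value_iter Q n xref)
    = (fun n => value_iter Q n (i, 0%N) - value_iter Q n xref).
  by apply: funext => n; rewrite value_iter_free2.
exact: lim_v.
Qed.

Lemma arg_T1P (R : realType) (Q : tandem R) v x a :
  arg_T1 Q v x a <-> best (mu1 Q) (c1 Q) (amax Q) (v x - v (depart1 x)) a.
Proof.
by split=> -[am H]; split=> // b bm; have := H b bm; rewrite /T1_obj; lra.
Qed.

Lemma arg_T2P (R : realType) (Q : tandem R) v x a :
  arg_T2 Q v x a <-> best (mu2 Q) (c2 Q) (bmax Q) (v x - v (depart2 x)) a.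
Proof.
by split=> -[am H]; split=> // b bm; have := H b bm; rewrite /T2_obj; lra.
Qed.

(** * Propagation of tight inequalities through the optimality equation *)

Section Optimality.
Context (R : realType) (Q : tandem R) (xref : state) (v : state -> R) (g : R).
Context (f1 f2 : nat -> R).
Hypotheses (Qm : tandem_model Q) (v_lim : is_relative_value Q xref v).
Hypothesis v_opt : forall x : state, T Q v x = v x + g.
Hypothesis irr : irreducible Q (fun x : state => (f1 x.1, f2 x.2)).
Hypothesis f_local : local_minimizers Q v f1 f2.

Let mm : multimodular v. Proof. exact: multimodular_relative_value v_lim. Qed.
Let S1 := server1 Qm.
Let S2 := server2 Qm.
Let F1 := gain (mu1 Q) (c1 Q) (amax Q).
Let F2 := gain (mu2 Q) (c2 Q) (bmax Q).

Let f1_best i j : best (mu1 Q) (c1 Q) (amax Q) (v (i.+1, j) - v (i, j.+1)) (f1 i.+1).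
Proof. by case: f_local => _ _ /(_ (i.+1, j)) /arg_T1P. Qed.

Let f2_best i j : best (mu2 Q) (c2 Q) (bmax Q) (v (i, j.+1) - v (i, j)) (f2 j.+1).
Proof. by case: f_local => _ _ _ /(_ (i, j.+1)) /arg_T2P. Qed.

Let f1_gt0 i : 0 < f1 i.+1.
Proof.
have [/andP[f0 _] _] := f1_best i 0.
by rewrite lt_neqAle f0 andbT eq_sym; apply/eqP/(irreducible_serves1 Qm irr).
Qed.

Let f2_gt0 j : 0 < f2 j.+1.
Proof.
have [/andP[f0 _] _] := f2_best 0 j.
by rewrite lt_neqAle f0 andbT eq_sym; apply/eqP/(irreducible_serves2 Qm irr).
Qed.

Let G1 x := F1 (v x - v (depart1 x)).
Let G2 x := F2 (v x - v (depart2 x)).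

Let G2_0 i : G2 (i, 0%N) = 0.
Proof. by rewrite /G2 /= subrr; exact: gain0 S2. Qed.

Let opt i j : lam Q * v (i.+1, j) + T1 Q v (i, j) + T2 Q v (i, j)
  + (h1 Q * i%:R + h2 Q * j%:R) = v (i, j) + g.
Proof. exact: v_opt (i, j). Qed.

(* Every term of the optimality equation is convex in x_2, so that equality in
   the sum forces equality in each term. *)
Let tight2 i j :
  v (i, j) + v (i, j.+2) = v (i, j.+1) + v (i, j.+1) ->
  G2 (i, j) + G2 (i, j.+2) = G2 (i, j.+1) + G2 (i, j.+1).
Proof.
move=> E.
have := multimodular_convex2 i j (multimodular_T1 Qm mm).
have := multimodular_convex2 i j (multimodular_T2 Qm mm).
have := ler_wpM2l (ltW (lam_gt0 Qm)) (multimodular_convex2 i.+1 j mm).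
have := opt i j; have := opt i j.+1; have := opt i j.+2.
have := congr1 ( *%R (mu2 Q (bmax Q))) E.
rewrite !T2E// -/F2 -!/(G2 _).
by rewrite -!natr1 => *; lra.
Qed.

(** The same argument for inequality 01. Since lam > 0, the arrival term moves tightness from i to i
    + 1. *)
Let tight1 i j :
  v (i, j.+1) + v (i.+2, j) = v (i.+1, j.+1) + v (i.+1, j) ->
  [/\ v (i.+1, j.+1) + v (i.+3, j) = v (i.+2, j.+1) + v (i.+2, j),
      G1 (i, j.+1) + G1 (i.+2, j) = G1 (i.+1, j.+1) + G1 (i.+1, j) &
      G2 (i, j.+1) + G2 (i.+2, j) = G2 (i.+1, j.+1) + G2 (i.+1, j)].
Proof.
move=> E; have l0 := lam_gt0 Qm.
have := multimodular01 (multimodular_T1 Qm mm) i j.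
have := multimodular01 (multimodular_T2 Qm mm) i j.
have := ler_wpM2l (ltW l0) (multimodular01 mm i.+1 j).
have := opt i j.+1; have := opt i.+2 j; have := opt i.+1 j.+1; have := opt i.+1 j.
have := congr1 ( *%R (mu1 Q (amax Q))) E.
have := congr1 ( *%R (mu2 Q (bmax Q))) E.
rewrite !T1E// !T2E// -/F1 -/F2 -!/(G1 _) -!/(G2 _).
rewrite -!natr1 => *; split; [|lra|lra].
by apply: (mulfI (lt0r_neq0 l0)); lra.
Qed.

Let convex2 i j : v (i, j.+1) + v (i, j.+1) <= v (i, j) + v (i, j.+2).
Proof. exact: multimodular_convex2. Qed.

Let linear2_absurd d : (forall i, v (i, 1%N) - v (i, 0%N) = d) ->
  (forall i, v (i, 2%N) - v (i, 1%N) = d) -> False.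
Proof.
move=> L0 L1.
(* [G2] is 0 at x_2 = 0 and F2 d at x_2 = 1, 2, so tightness reads F2 d = 2 * F2 d. *)
have E0 : F2 d = 0.
  have := @tight2 0 0 ltac:(have := L0 0%N; have := L1 0%N; lra).
  by rewrite G2_0 /G2 /= L0 L1; lra.
(* The two equations differ by (lam + mu1(amax) + mu2(bmax)) * d + h2 = d, and the total rate is
   1. *)
have h20 : h2 Q = 0.
  have := opt 0 0; have := opt 0 1; rewrite !T1E// !T2E// -/F1 -/F2.
  rewrite /= !subrr L0 E0 (gain0 S1 : F1 0 = 0) (gain0 S2 : F2 0 = 0).
  have := congr1 ( *%R (lam Q)) (L0 1%N).
  have := congr1 ( *%R (mu1 Q (amax Q))) (L0 0%N).
  have := congr1 ( *%R (mu2 Q (bmax Q))) (L0 0%N).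
  have := congr1 ( *%R^~ d) (normalized Qm); have := L0 0%N.
  by rewrite /= !mulr0 !mulr1; lra.
have := f2_best 0 0; rewrite (relative_value_free2 0 1 Qm h20 v_lim) subrr.
by move=> /(best0 S2) f0; have := f2_gt0 0; rewrite f0 ltxx.
Qed.

(** Tightness at (i, j + 1) equates the gain one level down with F2 d; node 2 being served there,
    [gain_inj] equates the arguments. *)
Let linear2_down j d :
  (forall i, v (i, j.+2) - v (i, j.+1) = d) ->
  (forall i, v (i, j.+3) - v (i, j.+2) = d) ->
  forall i, v (i, j.+1) - v (i, j) = d.
Proof.
move=> L1 L2 i.
have := @tight2 i j.+1 ltac:(have := L1 i; have := L2 i; lra).
rewrite /G2 /= L1 L2 => E; apply/esym/(gain_inj S2 (f2_best i j) (f2_gt0 j)).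
  by have := convex2 i j; have := L1 i; lra.
by rewrite -/F2; lra.
Qed.

Let linear1_absurd d :
  (forall j, v (1%N, j) - v (0%N, j.+1) = d) ->
  (forall j, v (2%N, j) - v (1%N, j.+1) = d) -> False.
Proof.
move=> L0 L1.
(* Tightness travels to all larger i. *)
have L i : (forall j, v (i.+1, j) - v (i, j.+1) = d) /\
           (forall j, v (i.+2, j) - v (i.+1, j.+1) = d).
  elim: i => [//|i [Li Li1]]; split=> // j.
  have [] := @tight1 i j; first by have := Li j; have := Li1 j; lra.
  by have := Li1 j; lra.
have {}L i : forall j, v (i.+1, j) - v (i, j.+1) = d by have [] := L i.
(* At j = 0 two of the node 2 gains vanish; the other two are equal, and [gain_inj] applies. *)
have D i : v (i.+1, 1%N) - v (i.+1, 0%N) = v (i, 1%N) - v (i, 0%N).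
  have [] := @tight1 i 0; first by have := L i 0%N; have := L i.+1 0%N; lra.
  rewrite !G2_0 /G2 /= => _ _ E.
  apply: (gain_inj S2 (f2_best i 0) (f2_gt0 0)).
    by have := multimodular02 mm i 0; lra.
  by rewrite -/F2; lra.
have {}D i : v (i, 1%N) - v (i, 0%N) = v (0%N, 1%N) - v (0%N, 0%N).
  by elim: i => // i IH; rewrite D.
apply: (linear2_absurd D) => i.
by have := L i 0%N; have := L i 1%N; have := D i.+1; lra.
Qed.

(** The lower gain in the tight equality sits at x_2 = j + 1, so x_2 = 0 is not reached and is
    recovered later from locality of the minimizers. *)
Let linear1_down i d :
  (forall j, v (i.+2, j) - v (i.+1, j.+1) = d) ->
  (forall j, v (i.+3, j) - v (i.+2, j.+1) = d) ->
  forall j, v (i.+1, j.+1) - v (i, j.+2) = d.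
Proof.
move=> L1 L2 j; have [] := @tight1 i.+1 j; first by have := L1 j; have := L2 j; lra.
rewrite /G1 /= !L1 L2 => _ E _.
apply/esym/(gain_inj S1 (f1_best i j.+1) (f1_gt0 i)).
  by have := multimodular01 mm i j.+1; have := L1 j.+1; lra.
by rewrite -/F1; lra.
Qed.

(** * Monotonicity of the minimizers *)

Lemma arg_T2_mono x b1 b2 :
  arg_T2 Q v (add_e2 x) b1 -> arg_T2 Q v x b2 -> b2 <= b1.
Proof.
case: x => i [|j]; rewrite /add_e2 /= => H1 H2.
  move/arg_T2P: H2; rewrite /= subrr => /(best0 S2) ->.
  by case: H1 => /andP[].
rewrite leNgt; apply/negP => lt.
have [_ loc _ _] := f_local.
(* By locality the assumed inversion b1 < b2 occurs for every x_1. *)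
have B1 k : best (mu2 Q) (c2 Q) (bmax Q) (v (k, j.+2) - v (k, j.+1)) b1.
  by apply/(arg_T2P _ _ (k, j.+2)); rewrite (loc _ (i, j.+2)).
have B2 k : best (mu2 Q) (c2 Q) (bmax Q) (v (k, j.+1) - v (k, j)) b2.
  by apply/(arg_T2P _ _ (k, j.+1)); rewrite (loc _ (i, j.+1)).
(* A strict increase would order the minimizers, so both actions tie at a common decrease. *)
have E k : v (k, j.+2) - v (k, j.+1) = v (k, j.+1) - v (k, j).
  have := convex2 k j; case: (ltgtP (v (k, j.+1) - v (k, j))
    (v (k, j.+2) - v (k, j.+1))) => // [l _|]; last by lra.
  by have := best_mono S2 l (B2 k) (B1 k); rewrite leNgt lt.
have C k : v (k, j.+1) - v (k, j) = v (i, j.+1) - v (i, j).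
  apply: (best_inj S2 lt) => //; rewrite -E; exact: B1.
move: (C); have {}E k : v (k, j.+2) - v (k, j.+1) = v (i, j.+1) - v (i, j).
  by rewrite E C.
move: E; move: (v (i, j.+1) - v (i, j)) => d.
clear H1 H2 B1 B2 C.
(* Linearity descends to x_2 = 0, where it is absurd. *)
elim: j => [|j IH] L1 L0; first exact: linear2_absurd L0 L1.
by apply: IH => //; exact: linear2_down.
Qed.

Lemma arg_T1_mono x a1 a2 :
  arg_T1 Q v (add_e1 x) a1 -> arg_T1 Q v x a2 -> a2 <= a1.
Proof.
case: x => [[|i] j]; rewrite /add_e1 /= => H1 H2.
  move/arg_T1P: H2; rewrite /= subrr => /(best0 S1) ->.
  by case: H1 => /andP[].
rewrite leNgt; apply/negP => lt.
have [loc _ _ _] := f_local.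
have B1 k : best (mu1 Q) (c1 Q) (amax Q) (v (i.+2, k) - v (i.+1, k.+1)) a1.
  by apply/(arg_T1P _ _ (i.+2, k)); rewrite (loc _ (i.+2, j)).
have B2 k : best (mu1 Q) (c1 Q) (amax Q) (v (i.+1, k) - v (i, k.+1)) a2.
  by apply/(arg_T1P _ _ (i.+1, k)); rewrite (loc _ (i.+1, j)).
have E k : v (i.+2, k) - v (i.+1, k.+1) = v (i.+1, k) - v (i, k.+1).
  have := multimodular01 mm i k; case: (ltgtP (v (i.+1, k) - v (i, k.+1))
    (v (i.+2, k) - v (i.+1, k.+1))) => // [l _|]; last by lra.
  by have := best_mono S1 l (B2 k) (B1 k); rewrite leNgt lt.
set d := v (i.+1, 0%N) - v (i, 1%N).
have d1 : best (mu1 Q) (c1 Q) (amax Q) d a1 by rewrite /d -E; exact: B1.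
have d2 : best (mu1 Q) (c1 Q) (amax Q) d a2 by exact: B2.
have C k : v (i.+1, k) - v (i, k.+1) = d.
  apply: (best_inj S1 lt) => //; rewrite -E; exact: B1.
move: (C); have {}E k : v (i.+2, k) - v (i.+1, k.+1) = d by rewrite E C.
move: E; move: d d1 d2 {C} => d d1 d2; clear B1 B2 H1 H2.
elim: i => [|i IH] L1 L0; first exact: linear1_absurd L0 L1.
apply: IH => // k.
have D := linear1_down L0 L1.
case: k => [|k]; last exact: D.
(* (i + 1, 0) has the minimizers of (i + 1, 1), where the decrease is [d]; the tie between [a1] and
   [a2] then forces [d] at (i + 1, 0) too. *)
have S0 a : best (mu1 Q) (c1 Q) (amax Q) d a ->
    best (mu1 Q) (c1 Q) (amax Q) (v (i.+1, 0%N) - v (i, 1%N)) a.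
  rewrite -(D 0%N) => /(arg_T1P _ _ (i.+1, 1%N)).
  by rewrite (loc _ (i.+1, 0%N))// => /arg_T1P.
by apply: (best_inj S1 lt) => //; exact: S0.
Qed.

End Optimality.

Theorem theorem1 (R : realType) (Q : tandem R) (xref : state) (v : state -> R)
    (g : R) (f1 f2 : nat -> R)
    (Qmodel : tandem_model Q)
    (v_lim : is_relative_value Q xref v)
    (v_opt : forall x : state, T Q v x = v x + g)
    (f_opt : optimal_policy Q (fun x : state => (f1 x.1, f2 x.2)) g)
    (f_local : local_minimizers Q v f1 f2) :
  (forall (x : state) (b1 b2 : R),
     arg_T2 Q v (add_e2 x) b1 -> arg_T2 Q v x b2 -> b1 >= b2) /\
  (forall (x : state) (a1 a2 : R),
     arg_T1 Q v (add_e1 x) a1 -> arg_T1 Q v x a2 -> a1 >= a2).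
Proof.
have [[_ irr _] _ _] := f_opt.
by split=> x y z; [exact: arg_T2_mono f_local _ _ _|exact: arg_T1_mono f_local _ _ _].
Qed.
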